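(* Let $\chi_1,\chi_2$ be nontrivial primitive Dirichlet characters of respective conductors $q_1,q_2$ with $\chi_1\chi_2(-1)=1$. Then \[ S_{\chi_1,\chi_2}(\Gamma_1(q_1q_2)) \subseteq \frac{1}{\gcd(q_1,q_2)}\,\mathbb{Z}[\chi_1,\chi_2]. \]
   Context: $B_1(x)=0$ if $x\in\mathbb{Z}$ and $B_1(x)=x-\lfloor x\rfloor-\tfrac12$ otherwise. $\Gamma_0(N)$ is the group of matrices $\begin{pmatrix}a&b\\c&d\end{pmatrix}\in SL_2(\mathbb{Z})$ with $N\mid c$, and $\Gamma_1(N)$ the subgroup with additionally $a\equiv d\equiv 1 \pmod N$. For $\gamma=\begin{pmatrix}a&b\\c&d\end{pmatrix}\in\Gamma_0(q_1q_2)$ with $c\ge 1$, the newform Dedekind sum is \[S_{\chi_1,\chi_2}(\gamma)=S_{\chi_1,\chi_2}(a,c)=\sum_{j \bmod c}\ \sum_{n \bmod q_1}\overline{\chi_2}(j)\overline{\chi_1}(n)B_1\Big(\frac{j}{c}\Big)B_1\Big(\frac{n}{q_1}+\frac{aj}{c}\Big);\] it is extended to all of $\Gamma_0(q_1q_2)$ by $S_{\chi_1,\chi_2}(\gamma)=0$ if $c=0$ and $S_{\chi_1,\chi_2}(\gamma)=S_{\chi_1,\chi_2}(-\gamma)$ if $c<0$ (this is the map arising from newform Eisenstein series, which satisfies $S(\gamma_1\gamma_2)=S(\gamma_1)+\chi_1\overline{\chi_2}(d_1)S(\gamma_2)$ where $d_1$ is the lower-right entry of $\gamma_1$). $F_{\chi_1,\chi_2}$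 denotes the smallest number field containing all values of $\chi_1$ and $\chi_2$, and $\mathbb{Z}[\chi_1,\chi_2]$ denotes the ring of integers of $F_{\chi_1,\chi_2}$. *)

(* Defs.v *)
From mathcomp Require Import all_boot all_order all_algebra all_field.

Set Implicit Arguments.
Unset Strict Implicit.
Unset Printing Implicit Defensive.

Import Order.TTheory GRing.Theory Num.Theory.
Local Open Scope ring_scope.

(* Values of Dirichlet characters are 0 or roots of unity, so nothing is lost
   by taking them in algC instead of the complex numbers. *)
Definition dirichlet_character (q : nat) (chi : int -> algC) : Prop :=
  [/\ (0 < q)%N,
      forall m n : int, (m = n %[mod q])%Z -> chi m = chi n,
      chi 1 = 1,
      forall m n : int, chi (m * n) = chi m * chi n
    & forall n : int, (chi n != 0) = coprimez n q].

Definition trivial_character (q : nat) (chi : int -> algC) : Prop :=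
  forall n : int, coprimez n q -> chi n = 1.

Definition induced_from (q d : nat) (chi : int -> algC) : Prop :=
  exists2 psi : int -> algC, dirichlet_character d psi
    & forall n : int, coprimez n q -> chi n = psi n.

(* A primitive character of conductor q: a character modulo q that is not
   induced from any proper divisor of q. *)
Definition primitive_character (q : nat) (chi : int -> algC) : Prop :=
  dirichlet_character q chi /\
  forall d : nat, (d %| q)%N -> induced_from q d chi -> d = q.

Definition B1 (x : rat) : rat :=
  if x \is a Num.int then 0 else x - (Num.floor x)%:~R - 2%:R^-1.

Definition Gamma0 (N : nat) : {pred 'M[int]_2} :=
  [pred g : 'M[int]_2 | (\det g == 1) && (N %| g 1%R 0%R)%Z].

Definition Gamma1 (N : nat) : {pred 'M[int]_2} :=
  [pred g : 'M[int]_2 | [&& g \in Gamma0 N,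
     (g 0%R 0%R == 1 %[mod N])%Z & (g 1%R 1%R == 1 %[mod N])%Z]].

(* The double sum S(a, c) for c >= 1. *)
Definition dedekind_sum_ac (q1 : nat) (chi1 chi2 : int -> algC)
    (a : int) (c : nat) : algC :=
  \sum_(j < c) \sum_(n < q1)
    (chi2 j%:Z)^* * (chi1 n%:Z)^* *
    ratr (B1 (j%:R / c%:R) * B1 (n%:R / q1%:R + a%:~R * j%:R / c%:R)).

(* For c < 0 the double sum is taken at the entries -a, -c of -g. *)
Definition newform_dedekind_sum (q1 : nat) (chi1 chi2 : int -> algC)
    (g : 'M[int]_2) : algC :=
  let a := g 0 0 in let c := g 1 0 in
  if c == 0 then 0
  else if 0 < c then dedekind_sum_ac q1 chi1 chi2 a `|c|%N
  else dedekind_sum_ac q1 chi1 chi2 (- a) `|c|%N.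

(* F_{chi1,chi2}: the intersection of all subfields of algC containing the
   values of chi1 and chi2 (automatically a number field, since these values
   are finitely many algebraic numbers). *)
Definition value_field (chi1 chi2 : int -> algC) (x : algC) : Prop :=
  forall K : {pred algC}, divring_closed K ->
    (forall n : int, chi1 n \in K) -> (forall n : int, chi2 n \in K) ->
    x \in K.

(* Z[chi1,chi2]: the ring of integers of F_{chi1,chi2}. *)
Definition value_ring (chi1 chi2 : int -> algC) (x : algC) : Prop :=
  value_field chi1 chi2 x /\ x \in Aint.

(* Main.v *)
(* Write c = q1 q2 m, M = q2 m, F and P for the conjugates of chi2 and chi1,
   and G(i) = sum_n P(n) ((n M + i) mod c).  As P and F sum to zero over a
   period, S(a, c) = c^-2 sum_j F(j) j G(a j).  Substituting j = d i mod c
   with d inverse to a turns j into d i - c floor(d i / c); the first part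
   vanishes because sum_i F(i) i G(i) = 0, and in the second one G(i) is
   congruent mod c to a constant.  This gives
     S(a, c) = B_{1,P} B_{1,F} (1 - F(d) d)  modulo algebraic integers,
   where q1 B_{1,P} and q2 B_{1,F} are integral, so that S(a, c) is integral
   as soon as d = 1 mod q1 q2; the same holds for d = -1, since B_{1,F} = 0
   when F is even. *)
Require Import Defs.
From HB Require Import structures.
From mathcomp Require Import all_boot all_order all_algebra all_field.
From mathcomp Require Import cyclic ring.

Set Implicit Arguments.
Unset Strict Implicit.
Unset Printing Implicit Defensive.

Import Order.TTheory GRing.Theory Num.Theory.
Local Open Scope ring_scope.

(** * Sums over complete residue systems *)

Lemma ord_pos (c : nat) : 'I_c -> (0 < c)%N.
Proof. by case=> j; apply: leq_ltn_trans. Qed.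

Lemma residue_bound (c : nat) (x : int) : (0 < c)%N -> (`|(x %% c)%Z| < c)%N.
Proof.
move=> c_gt0; rewrite -ltz_nat gez0_abs ?modz_ge0 -?lt0n //.
by rewrite -{2}[c]absz_nat; apply: ltz_mod; rewrite -lt0n.
Qed.

(** Multiplication by a unit [u] and translation by [v] permute the residues mod [c]. *)
Lemma sum_residues_affine (V : nmodType) (c : nat) (h : int -> V) (u v : int) :
  coprimez u c -> (forall m n : int, (m = n %[mod c])%Z -> h m = h n) ->
  \sum_(j < c) h (u * j%:Z + v) = \sum_(j < c) h j%:Z.
Proof.
move=> co_uc per_h.
pose f (j : 'I_c) := Ordinal (residue_bound (u * j%:Z + v) (ord_pos j)).
have fE (j : 'I_c) : (f j)%:Z = ((u * j%:Z + v) %% c)%Z.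
  by rewrite /= gez0_abs ?modz_ge0 // -lt0n (ord_pos j).
have f_inj : injective f.
  move=> i j /(congr1 (fun k : 'I_c => k%:Z)); rewrite !fE => /eqP.
  rewrite eqz_mod_dvd opprD addrACA subrr addr0 -mulrBr.
  rewrite Gauss_dvdzr 1?coprimez_sym // -eqz_mod_dvd !modz_nat.
  by rewrite !modn_small // => /eqP[]/val_inj.
rewrite [RHS](reindex_inj f_inj); apply: eq_bigr => j _.
by apply: per_h; rewrite fE modz_mod.
Qed.

Lemma sum_blocks (V : nmodType) (M q : nat) (h : nat -> V) :
  \sum_(i < M * q) h i = \sum_(t < q) \sum_(s < M) h (M * t + s)%N.
Proof.
rewrite -(big_mkord xpredT) mulnC big_nat_mul big_mkord.
apply: eq_bigr => t _; rewrite -{1}[(t * M)%N]add0n big_addn mulSn addnK.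
by rewrite big_mkord; apply: eq_bigr => s _; rewrite addnC mulnC.
Qed.

(** [value_field] quantifies over bare predicates; packing one as a structure makes the [rpred]
    lemmas apply to it. *)
Lemma divring_closed_pack (K : {pred algC}) :
  divring_closed K -> exists S : divringClosed algC, K =i S.
Proof.
move=> Kdiv; pose S : divringClosed algC := HB.pack_for (divringClosed algC)
  (K : algC -> bool) (GRing.isDivringClosed.Build _ _ Kdiv).
by exists S.
Qed.

(** * Values and sums of Dirichlet characters *)

Section DirichletCharacters.
Variables (q : nat) (chi : int -> algC) (chiD : dirichlet_character q chi).

Lemma dirichlet_conj : dirichlet_character q (fun n => (chi n)^*).
Proof.
case: chiD => q_gt0 per one mul nz; split=> // [m n /per -> //|||n].
- by rewrite one conjC1.
- by move=> m n; rewrite mul rmorphM.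
by rewrite conjC_eq0.
Qed.

Lemma dirichlet_unity_root (n : int) : coprimez n q -> (totient q).-unity_root (chi n).
Proof.
case: chiD => q_gt0 per one mul nz co_nq.
have pow k : chi (n ^+ k) = chi n ^+ k.
  by elim: k => [|k IH]; rewrite ?expr0 // !exprS mul IH.
apply/unity_rootP; rewrite -pow -one; apply: per.
(* Euler's theorem is applied to naturals, so [n] is replaced by its residue [r]. *)
have [r Er] : exists r : nat, (n = r %[mod q])%Z.
  exists `|(n %% q)%Z|%N; rewrite gez0_abs ?modz_ge0 -?lt0n // modz_mod //.
rewrite -modzXm Er modzXm.
have -> : r%:Z ^+ totient q = (r ^ totient q)%N by rewrite -[in LHS](natz r) -natrX natz.
rewrite !modz_nat; congr (Posz _); apply: Euler_exp_totient.
rewrite -[coprime _ _]/(coprimez r q).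
by rewrite /coprimez -gcdz_modl -Er gcdz_modl.
Qed.

Lemma dirichlet_Aint (n : int) : chi n \in Aint.
Proof.
have [co_nq|nco] := boolP (coprimez n q).
  apply: (@Aint_unity_root (totient q)); last exact: dirichlet_unity_root.
  by rewrite totient_gt0; case: chiD.
by case: chiD => _ _ _ _ nz; move: nco; rewrite -nz negbK => /eqP->; apply: Aint0.
Qed.

(** With [0^-1 = 0] this covers every [n]. It places conjugate values in any field containing the
    values of [chi], since such a field is not assumed closed under conjugation. *)
Lemma dirichlet_conjV (n : int) : (chi n)^* = (chi n)^-1.
Proof.
have [co_nq|nco] := boolP (coprimez n q).
  rewrite invC_norm.
  have /unity_rootP /(congr1 Num.norm) := dirichlet_unity_root co_nq.
  rewrite normrX normr1 => /eqP; rewrite pexprn_eq1 // => /orP[|/eqP->].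
    by rewrite -leqn0 leqNgt totient_gt0; case: chiD => ->.
  by rewrite expr1n invr1 mul1r.
by case: chiD => _ _ _ _ nz; move: nco; rewrite -nz negbK => /eqP->; rewrite conjC0 invr0.
Qed.

(** Multiplication by a unit [n] permutes the residues, so [chi n] fixes the sum; were the sum
    nonzero, every such [chi n] would be 1. *)
Lemma dirichlet_sum0 : ~ trivial_character q chi -> \sum_(j < q) chi j%:Z = 0.
Proof.
case: chiD => q_gt0 per one mul nz ntriv; apply/eqP/negPn/negP => sum_neq0.
case: ntriv => n co_nq; apply: (mulIf sum_neq0); rewrite mul1r.
rewrite -[RHS](@sum_residues_affine _ _ _ n 0) // mulr_sumr.
by apply: eq_bigr => j _; rewrite addr0 mul.
Qed.

End DirichletCharacters.

(** * The sawtooth function at non-integral fractions *)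

Lemma B1_frac (k : int) (c : nat) : (0 < c)%N -> ~~ (c %| k)%Z ->
  B1 (k%:~R / c%:R) = (k %% c)%Z%:~R / c%:R - 2%:R^-1.
Proof.
move=> c_gt0 ndvd; have c_neq0 : c%:R != 0 :> rat by rewrite pnatr_eq0 -lt0n.
have kE : k%:~R / c%:R = (k %/ c)%Z%:~R + (k %% c)%Z%:~R / c%:R :> rat.
  by rewrite {1}(divz_eq k c) rmorphD rmorphM /= -pmulrn mulrDl mulfK.
have r_ge0 : (0 : rat) <= (k %% c)%Z%:~R / c%:R.
  by rewrite divr_ge0 ?ler0n // ler0z modz_ge0 // -lt0n.
have r_lt1 : (k %% c)%Z%:~R / c%:R < 1 :> rat.
  rewrite ltr_pdivrMr ?ltr0n // mul1r pmulrn ltr_int.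
  by apply: ltz_pmod; rewrite ltz_nat.
have floorE : Num.floor (k%:~R / c%:R : rat) = (k %/ c)%Z.
  by apply: floor_def; rewrite kE intrD lerDl r_ge0 ltrD2l.
rewrite /B1 floorE; case: ifP => [/intrP[z zE]|_]; last by rewrite kE; ring.
case/negP: ndvd; apply/dvdzP; exists z; apply: (@intr_inj rat).
by rewrite rmorphM /= -pmulrn -zE divfK.
Qed.

(** * First moments of characters *)

Lemma dirichlet_sum_mul (q m : nat) (chi : int -> algC) :
  dirichlet_character q chi -> ~ trivial_character q chi ->
  \sum_(j < q * m) chi j%:Z = 0.
Proof.
move=> chiD ntriv; rewrite (sum_blocks q m (fun i => chi i%:Z)) big1 // => t _.
rewrite -[RHS](dirichlet_sum0 chiD ntriv); apply: eq_bigr => s _.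
by case: chiD => _ per _ _ _; apply: per; rewrite PoszD PoszM mulrC modzMDl.
Qed.

(* q times the generalized Bernoulli number B_{1,chi}. *)
Definition moment (q : nat) (chi : int -> algC) : algC :=
  \sum_(r < q) chi r%:Z * r%:R.

(** Write [i = q m t + s] with [s < q m]. The weight depends on [t] only and [chi i = chi s]; the
    part [q m t] of the factor [i] is killed by the vanishing sum of [chi] over a block. *)
Lemma moment_blocks (q m k : nat) (chi : int -> algC) (g : nat -> algC) :
  dirichlet_character q chi -> ~ trivial_character q chi ->
  \sum_(i < (q * m) * k) chi i%:Z * i%:R * g (i %/ (q * m))%N =
  moment (q * m) chi * \sum_(t < k) g t.
Proof.
move=> chiD ntriv; have [->|m_gt0] := posnP m.
  by rewrite /moment muln0 mul0n !big_ord0 mul0r.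
have M_gt0 : (0 < q * m)%N by rewrite muln_gt0 m_gt0 andbT; case: chiD.
rewrite (sum_blocks _ k (fun i => chi i%:Z * i%:R * g (i %/ (q * m))%N)).
rewrite mulr_sumr; apply: eq_bigr => t _.
transitivity (\sum_(s < q * m) (chi s%:Z * (q * m * t)%:R * g t + chi s%:Z * s%:R * g t)).
  apply: eq_bigr => s _; rewrite mulnC divnMDl // divn_small // addn0.
  rewrite mulnC natrD mulrDr mulrDl -!mulrA; congr (_ * _ + _ * _).
    by case: chiD => _ per _ _ _; apply: per; rewrite PoszD -mulnA PoszM mulrC modzMDl.
  by case: chiD => _ per _ _ _; apply: per; rewrite PoszD -mulnA PoszM mulrC modzMDl.
rewrite big_split /= -!mulr_suml dirichlet_sum_mul // !mul0r add0r.
by rewrite /moment.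
Qed.

Lemma moment_mul (q m : nat) (chi : int -> algC) :
  dirichlet_character q chi -> ~ trivial_character q chi ->
  moment (q * m) chi = moment q chi * m%:R.
Proof.
move=> chiD ntriv; have := moment_blocks 1 m (fun=> 1) chiD ntriv.
rewrite muln1 sumr_const card_ord => <-.
by apply: eq_bigr => i _; rewrite mulr1.
Qed.

Lemma moment_Aint (q q' : nat) (chi : int -> algC) :
  dirichlet_character q chi -> moment q' chi \in Aint.
Proof.
move=> chiD; apply: rpred_sum => r _.
by rewrite rpredM ?rpred_nat // (dirichlet_Aint chiD).
Qed.

(** Replacing [r] by [q - r] turns the moment into [q] times the zero sum of [chi], minus the
    moment. *)
Lemma moment_even (q : nat) (chi : int -> algC) :
  dirichlet_character q chi -> ~ trivial_character q chi ->
  chi (-1) = 1 -> moment q chi = 0.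
Proof.
move=> chiD ntriv even; have [q_gt0 per one mul nz] := chiD.
have momentE : moment q chi = \sum_(r < q) chi r%:Z * (r%:Z %% q)%Z%:~R.
  by apply: eq_bigr => r _; rewrite modz_nat modn_small.
have momentN : moment q chi = - moment q chi.
  have co_N1 : coprimez (-1) q by rewrite coprimezE abszN coprime1n.
  rewrite {1}momentE.
  rewrite -(@sum_residues_affine _ _ (fun x => chi x * (x %% q)%Z%:~R) _ 0 co_N1).
    2: by move=> x y exy; rewrite (per _ _ exy) exy.
  have sum_q : \sum_(r < q) chi r%:Z * q%:R = 0.
    by rewrite -mulr_suml dirichlet_sum0 // mul0r.
  rewrite -[RHS]addr0 -[X in _ = _ + X]sum_q.
  rewrite momentE -sumrN -big_split /=; apply: eq_bigr => r _.
  rewrite addr0 mul even mul1r mulN1r -mulrN -mulrDr.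
  have [|r_neq0] := eqVneq (chi r%:Z) 0; first by move->; rewrite !mul0r.
  (* The residue of [- r] is [q - r] only for [r > 0]; at [r = 0] a nonzero [chi 0] forces [q = 1],
     hence a trivial character. *)
  congr (_ * _); case: (posnP r) => [r0|r_gt0].
    have q1 : q = 1%N by apply/eqP; move: r_neq0; rewrite nz r0 /coprimez gcd0z.
    case: ntriv => n _; rewrite -one; apply: per; rewrite q1.
    by apply/eqP; rewrite eqz_mod_dvd dvd1z.
  have -> : (- r%:Z = -1 * q%:Z + (q%:Z - r%:Z))%R by ring.
  rewrite modzMDl !modz_small ?ltz_nat ?lez_nat ?ltn_ord //.
    by rewrite rmorphB /= addrC -!pmulrn.
  by rewrite subr_ge0 lez_nat ltnW //= gtrBl ltz_nat.
have /eqP : moment q chi *+ 2 = 0 by rewrite mulr2n {1}momentN addNr.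
by rewrite mulrn_eq0 => /eqP.
Qed.

(** * The twisted residue sum [G] *)

Section Sawtooth.

Variables (q1 q2 m : nat) (P F : int -> algC).
Hypotheses (PD : dirichlet_character q1 P) (Pntriv : ~ trivial_character q1 P).
Hypotheses (FD : dirichlet_character q2 F) (Fntriv : ~ trivial_character q2 F).
Hypothesis m_gt0 : (0 < m)%N.

Let M := (q2 * m)%N.
Let c := (M * q1)%N.

Let q1_gt0 : (0 < q1)%N. Proof. by case: PD. Qed.
Let q2_gt0 : (0 < q2)%N. Proof. by case: FD. Qed.
Let M_gt0 : (0 < M)%N. Proof. by rewrite muln_gt0 q2_gt0. Qed.
Let c_gt0 : (0 < c)%N. Proof. by rewrite muln_gt0 M_gt0. Qed.

(** Since [M / c = 1 / q1], this is [c] times the sum of [P(n) B1(n / q1 + i / c)] when no argument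
    is an integer; the constant -1/2 drops out as [P] sums to zero. *)
Definition twisted_residue (i : int) : algC :=
  \sum_(n < q1) P n%:Z * (((n * M)%:Z + i) %% c)%Z%:~R.

Local Notation G := twisted_residue.

Let F_perM (x y : int) : F (M%:Z * x + y) = F y.
Proof.
case: FD => _ per _ _ _; apply: per.
by rewrite /M PoszM -mulrA mulrC modzMDl.
Qed.

Let F_perc (x y : int) : (x = y %[mod c])%Z -> F x = F y.
Proof.
move/eqP; rewrite eqz_mod_dvd => /dvdzP[k /eqP]; rewrite subr_eq => /eqP->.
by rewrite /c PoszM mulrCA F_perM.
Qed.

Lemma twisted_residue_per (x y : int) : (x = y %[mod c])%Z -> G x = G y.
Proof.
move=> exy; apply: eq_bigr => n _; congr (_ * _%:~R).
by rewrite -modzDmr exy modzDmr.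
Qed.

(** Write each residue as its argument minus [c] times the quotient. The shift [i] is multiplied by
    the zero sum of [P], and [u] collects the quotients. *)
Lemma twisted_residueE (i : int) :
  exists2 u : algC, u \in Aint & G i = M%:R * moment q1 P - c%:R * u.
Proof.
exists (\sum_(n < q1) P n%:Z * (((n * M)%:Z + i) %/ c)%Z%:~R).
  by apply: rpred_sum => n _; rewrite rpredM ?Aint_int ?(dirichlet_Aint PD).
have Pi : \sum_(n < q1) P n%:Z * i%:~R = 0.
  by rewrite -mulr_suml dirichlet_sum0 // mul0r.
rewrite -[RHS]addr0 -[X in _ = _ + X]Pi /moment !mulr_sumr -sumrB -big_split /=.
apply: eq_bigr => n _; have := divz_eq ((n * M)%:Z + i) c.
move: (divz _ _) (modz _ _) => k r /(congr1 (fun x : int => x%:~R : algC)).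
rewrite !rmorphD rmorphM /= -!pmulrn (natrM _ n M) => e.
have -> : (r%:~R : algC) = n%:R * M%:R + i%:~R - k%:~R * c%:R by rewrite e; ring.
by ring.
Qed.

(** For fixed [n], the map [t -> n + t] permutes the residues mod [q1], so the sum over [t] is
    independent of [n] and [P] sums to zero. *)
Lemma sum_twisted_residue_block : \sum_(t < q1) G (M * t)%N%:Z = 0.
Proof.
rewrite exchange_big /=.
have cst (n : 'I_q1) : \sum_(t < q1) P n%:Z * (((n * M)%:Z + (M * t)%N%:Z) %% c)%Z%:~R
    = P n%:Z * \sum_(t < q1) M%:R * (t%:Z %% q1)%Z%:~R.
  rewrite -(@sum_residues_affine _ _ (fun x => M%:R * (x %% q1)%Z%:~R) 1 n%:Z).
    2: by rewrite coprimezE coprime1n.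
    2: by move=> x y ->.
  rewrite mulr_sumr; apply: eq_bigr => t _; congr (_ * _).
  have -> : ((n * M)%:Z + (M * t)%N%:Z = M%:Z * (1 * t%:Z + n%:Z))%R.
    by rewrite !PoszM; ring.
  by rewrite /c PoszM -mulz_modr ?ltz_nat // rmorphM /= -pmulrn.
by rewrite (eq_bigr _ (fun n _ => cst n)) -mulr_suml dirichlet_sum0 // mul0r.
Qed.

(** As [M] divides [c], adding [s < M] to a multiple of [M] causes no wrap mod [c]: every residue
    grows by exactly [s], and [P] sums to zero. *)
Lemma twisted_residue_shift (t s : nat) : (s < M)%N ->
  G (M * t + s)%N%:Z = G (M * t)%N%:Z.
Proof.
move=> s_lt.
have Ps : \sum_(n < q1) P n%:Z * s%:R = 0.
  by rewrite -mulr_suml dirichlet_sum0 // mul0r.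
rewrite -[RHS]addr0 -[X in _ = _ + X]Ps -big_split /=.
apply: eq_bigr => n _; rewrite -mulrDr; congr (_ * _).
rewrite -!PoszD !modz_nat -!pmulrn -natrD; congr _%:R.
rewrite addnA (mulnC n) -mulnDr /c -muln_modr.
rewrite {1}(divn_eq (n + t) q1) mulnDr mulnCA -addnA modnMDl modn_small //.
apply: (@leq_trans (M * ((n + t) %% q1).+1)); first by rewrite mulnS addnC ltn_add2r.
by rewrite leq_mul2l ltn_mod q1_gt0 orbT.
Qed.

(* Equivalently, S(1, c) = 0. *)
Lemma sum_twisted_residue_id : \sum_(i < c) F i%:Z * i%:R * G i%:Z = 0.
Proof.
(* [G] is constant on blocks of length [M], so the sum of its block values factors out. *)
have := moment_blocks m q1 (fun t => G (M * t)%N%:Z) FD Fntriv.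
rewrite sum_twisted_residue_block mulr0 => sum0.
rewrite -[RHS]sum0; apply: eq_bigr => i _.
congr (_ * _); rewrite -(@twisted_residue_shift _ (i %% M)) ?ltn_mod //.
by rewrite mulnC -divn_eq.
Qed.

(** * Substitution by the inverse [d] of [a] mod [c] *)

Section Inverse.

Variables a d : int.
Hypothesis ad1 : (a * d = 1 %[mod c])%Z.

Let co_ac : coprimez a c.
Proof.
suff : coprimez (a * d) c by rewrite coprimezMl => /andP[].
by rewrite /coprimez -gcdz_modl ad1 gcdz_modl gcd1z.
Qed.

Let F_ad : F a * F d = 1.
Proof. by case: FD => _ _ one mul _; rewrite -mul -one; apply: F_perc. Qed.

Let F_mul x y : F (x * y) = F x * F y.
Proof. by case: FD. Qed.

(** Substitute [x = n M + a j]: as [F] has period dividing [M], [F j = F d * F x]. The sum over [j]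
    no longer depends on [n], and [P] sums to zero. *)
Lemma sum_twisted_residue : \sum_(j < c) F j%:Z * G (a * j%:Z) = 0.
Proof.
under eq_bigr do rewrite mulr_sumr.
rewrite exchange_big /=.
pose h x := F x * (x %% c)%Z%:~R.
have cst (n : 'I_q1) : \sum_(j < c) F j%:Z * (P n%:Z * (((n * M)%:Z + a * j%:Z) %% c)%Z%:~R)
    = P n%:Z * (F d * \sum_(j < c) h j%:Z).
  rewrite -(@sum_residues_affine _ _ h a (n * M)%:Z) //; last first.
    by move=> x y exy; rewrite /h (F_perc exy) exy.
  rewrite !mulr_sumr; apply: eq_bigr => j _; rewrite /h.
  rewrite [a * _ + _]addrC [X in F (X + _)]PoszM [X in F (X + _)]mulrC F_perM F_mul.
  rewrite mulrCA; congr (_ * _); rewrite !mulrA [F d * _]mulrC F_ad mul1r.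
  by [].
by rewrite (eq_bigr _ (fun n _ => cst n)) -mulr_suml dirichlet_sum0 // mul0r.
Qed.

(** Divided by [c ^ 2], the main term has coefficient [m / c = 1 / (q1 q2)], which turns the two
    moments into Bernoulli numbers. *)
Lemma sum_twisted_residue_moment :
  exists2 z : algC, z \in Aint &
    \sum_(j < c) F j%:Z * j%:R * G (a * j%:Z) =
    c%:R * m%:R * moment q1 P * moment q2 F * (1 - F d * d%:~R) + c%:R ^+ 2 * z.
Proof.
pose A := \sum_(i < c) F i%:Z * i%:R.
have AE : A = q1%:R * m%:R * moment q2 F.
  have := moment_blocks m q1 (fun=> 1) FD Fntriv.
  rewrite sumr_const card_ord moment_mul //= => e.
  transitivity (moment q2 F * m%:R * q1%:R); last by ring.
  by rewrite -e; apply: eq_bigr => i _; rewrite mulr1.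
pose r i := ((d * i) %% c)%Z; pose k i := ((d * i) %/ c)%Z.
have rE i : (r i)%:~R = d%:~R * i%:~R - c%:R * (k i)%:~R :> algC.
  have := divz_eq (d * i) c; rewrite -/(r i) -/(k i).
  move: (k i) (r i) => x y /(congr1 (fun z : int => z%:~R : algC)).
  by rewrite rmorphD !rmorphM /= -pmulrn => ->; ring.
(* Putting [i = a j] turns [r i] into [j], since [d a = 1] mod [c]. *)
have reindex (h : int -> algC) : (forall x y : int, (x = y %[mod c])%Z -> h x = h y) ->
    \sum_(i < c) F i%:Z * (r i%:Z)%:~R * h i%:Z =
    F a * \sum_(j < c) F j%:Z * j%:R * h (a * j%:Z).
  move=> per_h.
  rewrite -(@sum_residues_affine _ _ (fun x => F x * (r x)%:~R * h x) a 0 co_ac).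
    2: move=> x y exy; rewrite (F_perc exy) (per_h _ _ exy) /r.
    2: by rewrite -modzMmr exy modzMmr.
  rewrite mulr_sumr; apply: eq_bigr => j _; rewrite addr0 F_mul -!mulrA.
  congr (_ * (_ * (_ * _))); rewrite /r mulrA [d * a]mulrC -modzMml ad1 modzMml mul1r.
  by rewrite modz_nat modn_small.
(* The case [h = 1] evaluates the sum of [F i * r i] as [F a * A]; [rE] then isolates the
   quotients. *)
have k_sum : c%:R * \sum_(i < c) F i%:Z * (k i%:Z)%:~R = (d%:~R - F a) * A.
  have := reindex (fun=> 1) (fun _ _ _ => erefl).
  under [in RHS]eq_bigr do rewrite mulr1.
  rewrite mulrBl => <-; rewrite /A !mulr_sumr -sumrB; apply: eq_bigr => i _.
  by rewrite rE; ring.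
have Fd_a : F d * F a = 1 by rewrite mulrC.
(* Solving for [u] makes it a function of [i]; [twisted_residueE] supplies its integrality. *)
pose u i := (M%:R * moment q1 P - G i) / c%:R.
have c_neq0 : c%:R != 0 :> algC by rewrite pnatr_eq0 -lt0n.
have uE i : G i = M%:R * moment q1 P - c%:R * u i by rewrite /u; field.
have u_int i : u i \in Aint.
  by have [v v_int e] := twisted_residueE i; rewrite /u e opprB addrC addrNK mulrC mulKf.
exists (F d * \sum_(i < c) F i%:Z * (k i%:Z)%:~R * u i%:Z).
  rewrite rpredM ?(dirichlet_Aint FD) //; apply: rpred_sum => i _.
  exact: rpredM (rpredM (dirichlet_Aint FD _) (Aint_int _)) (u_int _).
have T_eq := reindex _ twisted_residue_per.
have {T_eq} -> : \sum_(j < c) F j%:Z * j%:R * G (a * j%:Z) =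
    F d * \sum_(i < c) F i%:Z * (r i%:Z)%:~R * G i%:Z.
  by rewrite T_eq mulrA Fd_a mul1r.
(* Expand [r = d i - c k], then replace [G] by its constant minus [c u] in the [k] part only. *)
have -> : \sum_(i < c) F i%:Z * (r i%:Z)%:~R * G i%:Z =
   d%:~R * (\sum_(i < c) F i%:Z * i%:R * G i%:Z) -
   (M%:R * moment q1 P) * (c%:R * \sum_(i < c) F i%:Z * (k i%:Z)%:~R) +
   c%:R ^+ 2 * \sum_(i < c) F i%:Z * (k i%:Z)%:~R * u i%:Z.
  move: (moment q1 P) uE => b uE'.
  rewrite !mulr_sumr -sumrB -big_split; apply: eq_bigr => i _ /=.
  by rewrite rE uE' -pmulrn; ring.
(* The first sum vanishes; the main term comes from [F d * (F a - d) = 1 - F d * d]. *)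
rewrite sum_twisted_residue_id k_sum AE.
have -> : c%:R = M%:R * q1%:R :> algC by rewrite natrM.
rewrite mulrDr; congr (_ + _); last by ring.
transitivity (M%:R * q1%:R * m%:R * moment q1 P * moment q2 F *
  (F d * F a - F d * d%:~R)); first by ring.
by rewrite Fd_a.
Qed.

End Inverse.

End Sawtooth.

(** * Membership in the field of values *)

Lemma dedekind_sum_value_field (q1 q2 : nat) (chi1 chi2 : int -> algC) (a : int) (c : nat) :
  dirichlet_character q1 chi1 -> dirichlet_character q2 chi2 ->
  value_field chi1 chi2 (dedekind_sum_ac q1 chi1 chi2 a c).
Proof.
move=> D1 D2 K /divring_closed_pack[S KS] K1 K2.
rewrite KS; apply: rpred_sum => j _; apply: rpred_sum => n _.
apply: rpredM; last exact: rpred_rat.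
rewrite (dirichlet_conjV D1) (dirichlet_conjV D2).
by apply: rpredM; rewrite rpredV -KS.
Qed.

(** * Integrality of the double sum *)

Section Integrality.

Variables (q1 q2 m : nat) (chi1 chi2 : int -> algC).
Hypotheses (D1 : dirichlet_character q1 chi1) (ntriv1 : ~ trivial_character q1 chi1).
Hypotheses (D2 : dirichlet_character q2 chi2) (ntriv2 : ~ trivial_character q2 chi2).
Hypothesis m_gt0 : (0 < m)%N.

Let P n := (chi1 n)^*.
Let F n := (chi2 n)^*.
Let c := (q2 * m * q1)%N.

Let PD : dirichlet_character q1 P. Proof. exact: dirichlet_conj. Qed.
Let FD : dirichlet_character q2 F. Proof. exact: dirichlet_conj. Qed.

Let Pntriv : ~ trivial_character q1 P.
Proof. by move=> t; apply: ntriv1 => n /t /(canRL (@conjCK _)); rewrite conjC1. Qed.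

Let Fntriv : ~ trivial_character q2 F.
Proof. by move=> t; apply: ntriv2 => n /t /(canRL (@conjCK _)); rewrite conjC1. Qed.

Let c_gt0 : (0 < c)%N.
Proof. by rewrite !muln_gt0 m_gt0; case: D1 => ->; case: D2 => ->. Qed.

Variables a d : int.
Hypothesis ad1 : (a * d = 1 %[mod c])%Z.

(** Otherwise [q2 = 1] and [F] is trivial. This keeps the arguments of [B1] away from the integers
    wherever [F j] is nonzero. *)
Let F_neq0_ndvd (j : int) : F j != 0 -> ~~ (q2 %| j)%Z.
Proof.
case: FD => q2_gt0 per one _ nz Fj; apply/negP => /dvdzP[k jE].
case: Fntriv => n _; rewrite -one; apply: per.
suff -> : q2 = 1%N by apply/eqP; rewrite eqz_mod_dvd dvd1z.
move: Fj; rewrite nz jE coprimezMl => /andP[_].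
by rewrite coprimezE absz_nat /coprime gcdnn => /eqP.
Qed.

(** Terms with [F j = 0] vanish on both sides; in the others both values of [B1] are a residue over
    [c] minus 1/2. One constant is killed by the sum of [P], the other by [sum_twisted_residue]. *)
Lemma dedekind_sum_twisted_residue :
  dedekind_sum_ac q1 chi1 chi2 a c =
  (c%:R ^+ 2)^-1 * \sum_(j < c) F j%:Z * j%:R * twisted_residue q1 q2 m P (a * j%:Z).
Proof.
have c_neq0 : c%:R != 0 :> algC by rewrite pnatr_eq0 -lt0n.
have q2_dvd_c : (q2%:Z %| c%:Z)%Z by rewrite /c -mulnA PoszM dvdz_mulr.
have co_aq2 : coprimez q2 a.
  suff : coprimez (a * d) c.
    by rewrite /c -mulnA PoszM coprimezMl coprimezMr coprimez_sym => /andP[/andP[]].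
  by rewrite /coprimez -gcdz_modl ad1 gcdz_modl gcd1z.
have inner (j : 'I_c) : \sum_(n < q1) F j%:Z * P n%:Z *
      ratr (B1 (j%:R / c%:R) * B1 (n%:R / q1%:R + a%:~R * j%:R / c%:R)) =
    F j%:Z * (j%:R / c%:R - 2%:R^-1) * (twisted_residue q1 q2 m P (a * j%:Z) / c%:R).
  have [Fj0|Fj] := eqVneq (F j%:Z) 0.
    by rewrite big1 ?Fj0 ?mul0r // => n _; rewrite !mul0r.
  have Ph : \sum_(n < q1) P n%:Z * (- 2%:R^-1) = 0.
    by rewrite -mulr_suml dirichlet_sum0 // mul0r.
  have -> : twisted_residue q1 q2 m P (a * j%:Z) / c%:R =
      \sum_(n < q1) P n%:Z * ((((n * (q2 * m))%:Z + a * j%:Z) %% c)%Z%:~R / c%:R - 2%:R^-1).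
    rewrite -[LHS]addr0 -[X in _ + X = _]Ph mulr_suml -big_split.
    by apply: eq_bigr => n _; rewrite mulrBr mulrA mulrN.
  rewrite mulr_sumr.
  apply: eq_bigr => n _.
  rewrite -[j%:R / c%:R]/((j%:Z)%:~R / c%:R) B1_frac //; last first.
    by apply: contra (F_neq0_ndvd Fj); apply: dvdz_trans q2_dvd_c.
  have -> : n%:R / q1%:R + a%:~R * j%:R / c%:R =
            ((n * (q2 * m))%:Z + a * j%:Z)%:~R / c%:R :> rat.
    have cE : c%:R = (q2 * m)%:R * q1%:R :> rat by rewrite -natrM.
    have : c%:R != 0 :> rat by rewrite pnatr_eq0 -lt0n.
    rewrite cE mulf_eq0 negb_or => /andP[M0 q0].
    rewrite rmorphD rmorphM /= -!pmulrn [(n * _)%:R]natrM.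
    by move: (q2 * m)%N M0 => M M0; field; rewrite M0 q0.
  rewrite B1_frac //; last first.
    (* As [q2] divides [n * (q2 * m)], it would divide [a j], hence [j], [a] being a unit mod
       [q2]. *)
    apply/negP => /(dvdz_trans q2_dvd_c); rewrite rpredDl.
      by rewrite Gauss_dvdzr // (negPf (F_neq0_ndvd Fj)).
    by rewrite mulnCA PoszM dvdz_mulr.
  have ratrE (k : int) : ratr (k%:~R / c%:R - 2%:R^-1) = k%:~R / c%:R - 2%:R^-1 :> algC.
    by rewrite rmorphB fmorph_div fmorphV /= ratr_int !ratr_nat.
  by rewrite rmorphM /= !ratrE modz_nat modn_small // -pmulrn !mulrA [X in X * _ = _]mulrAC.
rewrite /dedekind_sum_ac (eq_bigr _ (fun j _ => inner j)).
have := sum_twisted_residue PD Pntriv FD ad1.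
rewrite -/c => sum0.
rewrite -[RHS]subr0 -[X in _ - X](mulr0 (2%:R^-1 / c%:R)) -[X in _ - _ * X]sum0.
rewrite !mulr_sumr -sumrB; apply: eq_bigr => j _.
by field.
Qed.

(** The case [d = -1] serves matrices with negative lower-left entry, whose sum is taken at the
    entries of [- g]. *)
Lemma dedekind_sum_Aint :
  (d = 1 %[mod q1 * q2])%Z \/ (d = -1 %[mod q1 * q2])%Z ->
  dedekind_sum_ac q1 chi1 chi2 a c \in Aint.
Proof.
move=> d1.
have c_neq0 : c%:R != 0 :> algC by rewrite pnatr_eq0 -lt0n.
have cE : c%:R = q2%:R * m%:R * q1%:R :> algC by rewrite -!natrM.
have := c_neq0; rewrite cE !mulf_eq0 !negb_or => /andP[/andP[q20 m0] q10].
rewrite dedekind_sum_twisted_residue.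
have [z z_int ->] := sum_twisted_residue_moment PD Pntriv FD Fntriv m_gt0 ad1.
(* A factor [q1 q2] cancels the denominators of the two Bernoulli numbers. *)
suff [k E] : exists k : int, moment q2 F * (1 - F d * d%:~R) =
    moment q2 F * (k%:~R * (q1%:R * q2%:R)).
  rewrite -/c -[_ * moment q2 F * _]mulrA E.
  suff -> : (c%:R ^+ 2)^-1 * (c%:R * m%:R * moment q1 P *
      (moment q2 F * (k%:~R * (q1%:R * q2%:R))) + c%:R ^+ 2 * z) =
      moment q1 P * moment q2 F * k%:~R + z.
    by rewrite rpredD // !rpredM ?Aint_int ?(moment_Aint _ PD) ?(moment_Aint _ FD).
  by rewrite cE; field; rewrite q10 q20 m0.
have F_d (e : int) : (d = e %[mod q1 * q2])%Z -> F d = F e.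
  case: FD => _ per _ _ _ /eqP; rewrite eqz_mod_dvd => de.
  apply: per; apply/eqP; rewrite eqz_mod_dvd; apply: dvdz_trans de.
  by rewrite PoszM dvdz_mull.
have [_ _ one mul _] := FD.
case: d1 => dE; move: (dE) => /F_d ->; move/eqP: dE; rewrite eqz_mod_dvd => /dvdzP[k].
  move/eqP; rewrite subr_eq => /eqP->; exists (- k).
  by rewrite one rmorphD rmorphN !rmorphM /= -!pmulrn ?natrM; ring.
rewrite opprK => /eqP; rewrite eq_sym -subr_eq => /eqP <-.
(* For even [F] the moment is zero; for odd [F] the factor is [1 + d], a multiple of [q1 q2]. *)
have : F (-1) ^+ 2 == 1 by rewrite expr2 -mul -one.
rewrite sqrf_eq1 => /orP[/eqP even|/eqP->].
  by exists 0; rewrite (moment_even FD) // !mul0r.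
by exists k; rewrite rmorphB !rmorphM /= -!pmulrn ?natrM; ring.
Qed.

End Integrality.

(** * From double sums to elements of [Gamma1] *)

Theorem theorem1p6 (q1 q2 : nat) (chi1 chi2 : int -> algC)
    (prim1 : primitive_character q1 chi1)
    (prim2 : primitive_character q2 chi2)
    (ntriv1 : ~ trivial_character q1 chi1)
    (ntriv2 : ~ trivial_character q2 chi2)
    (parity : chi1 (-1) * chi2 (-1) = 1)
    (g : 'M[int]_2) (hg : g \in Gamma1 (q1 * q2)) :
  exists2 z : algC, value_ring chi1 chi2 z
    & newform_dedekind_sum q1 chi1 chi2 g = (gcdn q1 q2)%:R^-1 * z.
Proof.
have [[D1 _] [D2 _]] := (prim1, prim2).
have gcd_neq0 : (gcdn q1 q2)%:R != 0 :> algC.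
  by rewrite pnatr_eq0 -lt0n gcdn_gt0; case: D1 => ->.
(* Integrality and field membership pass from the sum to its product with the gcd, which serves as
   [z]. *)
suff [S_int S_field] : newform_dedekind_sum q1 chi1 chi2 g \in Aint /\
    value_field chi1 chi2 (newform_dedekind_sum q1 chi1 chi2 g).
  exists ((gcdn q1 q2)%:R * newform_dedekind_sum q1 chi1 chi2 g); last by rewrite mulKf.
  split; last by rewrite rpredM ?rpred_nat.
  move=> K Kdiv K1 K2; have := S_field K Kdiv K1 K2.
  by have [S KS] := divring_closed_pack Kdiv; rewrite !KS => ?; rewrite rpredM ?rpred_nat.
move: hg; rewrite !inE => /and3P[/andP[/eqP det1 Ndvd] _ /eqP d1].
have {}det1 : g 0 0 * g 1 1 - g 0 1 * g 1 0 = 1.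
  rewrite -det1 (expand_det_row _ 0) !big_ord_recl big_ord0 /cofactor !det_mx11 !mxE /=.
  have -> : lift 0 0 = 1%R :> 'I_2 by exact: val_inj.
  have -> : lift (1%R : 'I_2) 0 = 0%R :> 'I_2 by exact: val_inj.
  by rewrite expr0 expr1; ring.
rewrite /newform_dedekind_sum; case: eqP => [_|/eqP c_neq0].
  split; first exact: Aint0.
  by move=> K /divring_closed_pack[S KS] _ _; rewrite KS rpred0.
have [m m_gt0 cE] : exists2 m, (0 < m)%N & `|g 1%R 0%R|%N = (q2 * m * q1)%N.
  have /dvdnP[m cE] : (q1 * q2 %| `|g 1%R 0%R|)%N by [].
  exists m; last by rewrite cE; ring.
  by rewrite lt0n; apply: contra c_neq0 => /eqP m0; rewrite -absz_eq0 cE m0.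
have dvd_c : ((q2 * m * q1)%N%:Z %| g 1%R 0%R)%Z by rewrite dvdzE cE absz_nat.
(* The determinant relation makes the lower-right entry inverse to [a] mod [c]. *)
have ad1 : (g 0%R 0%R * g 1%R 1%R = 1 %[mod (q2 * m * q1)%N])%Z.
  apply/eqP; rewrite eqz_mod_dvd -det1 opprB addrCA subrr addr0.
  by rewrite dvdz_mull.
rewrite cE; case: ifP => _.
  split; last exact: dedekind_sum_value_field D1 D2.
  by apply: dedekind_sum_Aint ad1 _ => //; left.
split; last exact: dedekind_sum_value_field D1 D2.
apply: (@dedekind_sum_Aint _ _ _ _ _ D1 _ D2 _ _ _ (- g 1 1)) => //.
  by rewrite mulrNN.
right; apply/eqP; rewrite eqz_mod_dvd -opprD rpredN.
by rewrite -eqz_mod_dvd d1.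
Qed.
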